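(* Let $b'\in\mathbb C$ and let $h=b'U$ be the operator on $\mathbb C^2\otimes\mathbb C^2$ with $$U=\begin{pmatrix}0&1&1&1\\0&1&1&0\\0&1&1&0\\0&0&0&0\end{pmatrix}.$$ Let $L$ be an even positive integer, and on the periodic chain $(\mathbb C^2)^{\otimes L}$ let $H=\sum_{j=1}^{L}h_{j,j+1}$ (with $L+1\equiv1$) and $J_+=\sum_{j=1}^{L}(-1)^j\sigma_j^+$. Then $$[H,J_+]=0.$$
   Context: Matrices on $\mathbb C^2\otimes\mathbb C^2$ are written in the ordered basis $|00\rangle,|01\rangle,|10\rangle,|11\rangle$. $h_{j,j+1}$ is $h$ acting on the $j$-th and $(j+1)$-th tensor factors (in that order), site indices modulo $L$. $\sigma^+=\begin{pmatrix}0&1\\0&0\end{pmatrix}$ and $\sigma_j^+$ is $\sigma^+$ acting on the $j$-th factor. $[\cdot,\cdot]$ is the commutator. *)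

(* Defs.v *)
From mathcomp Require Import all_boot all_order all_algebra.
From mathcomp Require Import reals mxtens complex.

Set Implicit Arguments.
Unset Strict Implicit.
Unset Printing Implicit Defensive.

Import GRing.Theory.
Local Open Scope ring_scope.

(* Sites are 'I_L = {0, ..., L-1}; site j of the chain 1, ..., L is the ordinal
   j-1.  The standard basis of (K^2)^{(x) L} is indexed by the configurations
   s : 'I_L -> {0, 1}, numbered by enum_rank, and operators are identified with
   their matrices: A i j is the coefficient of the i-th basis vector in the
   image of the j-th one. *)
Notation config L := {ffun 'I_L -> 'I_2}.
Notation chain_op K L := 'M[K]_#|config L|.

Section Chain.
Variable K : comNzRingType.

Definition commutator n (A B : 'M[K]_n) : 'M[K]_n := A *m B - B *m A.

Definition mx_of_rows m n (rows : seq (seq K)) : 'M[K]_(m, n) :=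
  \matrix_(i < m, j < n) nth 0 (nth [::] rows i) j.

Variable L : nat.

Definition chain_mx (f : config L -> config L -> K) : chain_op K L :=
  \matrix_(x, y) f (enum_val x) (enum_val y).

(* A on the j-th tensor factor, identity on the others:
   <s| A_j |t> = <s_j| A |t_j> \prod_(i != j) delta_{s_i, t_i}. *)
Definition one_site (A : 'M[K]_2) (j : 'I_L) : chain_op K L :=
  chain_mx (fun s t => A (s j) (t j) * \prod_(i | i != j) (s i == t i)%:R).

(* B on the j-th and k-th tensor factors, in that order (meant for j != k);
   mxtens_index (a, b) = 2 a + b is the position of |ab> in the ordered basis
   |00>, |01>, |10>, |11>. *)
Definition two_site (B : 'M[K]_(2 * 2)) (j k : 'I_L) : chain_op K L :=
  chain_mx (fun s t =>
    B (mxtens_index (s j, s k)) (mxtens_index (t j, t k)) *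
    \prod_(i | (i != j) && (i != k)) (s i == t i)%:R).

(* ordS j is the cyclic successor j + 1 mod L. *)
Definition hamiltonian (h : 'M[K]_(2 * 2)) : chain_op K L :=
  \sum_(j < L) two_site h j (ordS j).

Definition sigma_plus : 'M[K]_2 := mx_of_rows 2 2 [:: [:: 0; 1]; [:: 0; 0]].

(* The exponent is j.+1 because the ordinal j is site j + 1. *)
Definition J_plus : chain_op K L :=
  \sum_(j < L) (-1) ^+ j.+1 *: one_site sigma_plus j.

Definition U_mx : 'M[K]_(2 * 2) :=
  mx_of_rows (2 * 2) (2 * 2)
    [:: [:: 0; 1; 1; 1];
        [:: 0; 1; 1; 0];
        [:: 0; 1; 1; 0];
        [:: 0; 0; 0; 0]].

End Chain.

Arguments J_plus K L : clear implicits.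
Arguments U_mx K : clear implicits.
Arguments sigma_plus K : clear implicits.

(* Main.v *)
(** The two-site matrix [U] and [D = sigma^+ (x) 1 - 1 (x) sigma^+] satisfy
    [U D = D U = 0].  The commutator of [h_{j,j+1}] with [J_+] only sees the
    terms of [J_+] at the sites [j] and [j+1]; these have opposite signs, also
    across the periodic boundary because [L] is even, so together they are a
    multiple of [D] acting on those sites. *)
Require Import Defs.
From mathcomp Require Import all_boot all_order all_algebra.
From mathcomp Require Import reals mxtens complex.

Import GRing.Theory.
Local Open Scope ring_scope.

Section ChainOperators.
Variables (K : comNzRingType) (L : nat).
Implicit Types (A : 'M[K]_2) (B : 'M[K]_(2 * 2)) (i j k : 'I_L)
  (s t : config L).

Definition update t i (a : 'I_2) : config L :=
  [ffun l => if l == i then a else t l].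

Lemma tr_one_site A i : (one_site A i)^T = one_site A^T i.
Proof.
apply/matrixP => x y; rewrite !mxE; congr (_ * _).
by apply: eq_bigr => l _; rewrite eq_sym.
Qed.

Lemma tr_two_site B j k : (two_site B j k)^T = two_site B^T j k.
Proof.
apply/matrixP => x y; rewrite !mxE; congr (_ * _).
by apply: eq_bigr => l _; rewrite eq_sym.
Qed.

Lemma prod_eq_natr (P : pred 'I_L) s t :
  \prod_(l | P l) (s l == t l)%:R = [forall (l | P l), s l == t l]%:R :> K.
Proof.
case: forall_inP => [st|nst].
  by rewrite big1 // => l Pl; rewrite st.
have /forall_inPn[l Pl /negbTE sl]: ~~ [forall (l | P l), s l == t l].
  by apply/forall_inP.
by rewrite (bigD1 l) //= sl mul0r.
Qed.

(** Column [y] of [one_site A i] is supported on the configurations agreeing with [enum_val y] off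
    [i], so only the value [a] at [i] is summed. *)
Lemma mulmx_one_siteE (M : chain_op K L) A i x y :
  (M *m one_site A i) x y =
  \sum_a M x (enum_rank (update (enum_val y) i a)) * A a (enum_val y i).
Proof.
rewrite mxE (reindex _ (onW_bij _ (@enum_rank_bij (config L)))) /=.
set t := enum_val y.
(* Group the configurations by their value at [i]; in each class only [update t i a] survives, since
   any other member differs from [t] at some site other than [i]. *)
rewrite (partition_big (fun u : config L => u i) predT) //=.
apply: eq_bigr => a _.
rewrite (bigD1 (update t i a)) /= ?ffunE ?eqxx // mxE enum_rankK.
rewrite !ffunE eqxx [X in _ * (_ * X)]big1 ?mulr1 => [|l /negbTE li]; last first.
  by rewrite ffunE li eqxx.
rewrite big1 ?addr0 // => u /andP[/eqP ui neq].
rewrite mxE enum_rankK -/t prod_eq_natr; case: forall_inP => [ut|]; last first.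
  by rewrite !mulr0.
case/eqP: neq; apply/ffunP => l; rewrite ffunE.
by case: eqVneq => [->//|li]; apply/eqP/ut.
Qed.

Lemma sum_mxtens_index (V : nmodType) m n (F : 'I_(m * n) -> V) :
  \sum_i F i = \sum_(a < m) \sum_(b < n) F (mxtens_index (a, b)).
Proof.
rewrite pair_big (reindex (@mxtens_index m n)) /=; last first.
  by exists (@mxtens_unindex m n) => p _; rewrite (mxtens_indexK, mxtens_unindexK).
by apply: eq_bigr => -[].
Qed.

(** In the double sum for the product of 4 by 4 matrices, the factor [1%:M] forces the second index
    to be [t k]; what is left is the sum over the value at [j]. *)
Lemma mulmx_two_one_site_l B A j k : j != k ->
  two_site B j k *m one_site A j = two_site (B *m (A *t 1%:M)) j k.
Proof.
move=> jk; apply/matrixP => x y; rewrite mulmx_one_siteE !mxE.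
set s := enum_val x; set t := enum_val y.
rewrite sum_mxtens_index mulr_suml; apply: eq_bigr => a _.
rewrite (bigD1 (t k)) //= [X in _ + X]big1 ?addr0 => [|b /negbTE bt]; last first.
  by rewrite tensmxE mxE bt !mulr0.
rewrite tensmxE [1%:M _ _]mxE eqxx mulr1 mxE enum_rankK -/s !ffunE eqxx.
rewrite [k == j]eq_sym (negbTE jk) mulrAC; congr (_ * _).
by apply: eq_bigr => l /andP[/negbTE lj _]; rewrite ffunE lj.
Qed.

Lemma mulmx_two_one_site_r B A j k : j != k ->
  two_site B j k *m one_site A k = two_site (B *m (1%:M *t A)) j k.
Proof.
move=> jk; apply/matrixP => x y; rewrite mulmx_one_siteE !mxE.
set s := enum_val x; set t := enum_val y.
rewrite sum_mxtens_index exchange_big mulr_suml; apply: eq_bigr => a _.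
rewrite (bigD1 (t j)) //= [X in _ + X]big1 ?addr0 => [|b /negbTE bt]; last first.
  by rewrite tensmxE mxE bt mul0r mulr0.
rewrite tensmxE [1%:M _ _]mxE eqxx mul1r mxE enum_rankK -/s !ffunE eqxx.
rewrite (negbTE jk) mulrAC; congr (_ * _).
by apply: eq_bigr => l /andP[_ /negbTE lk]; rewrite ffunE lk.
Qed.

(** Transposition reverses products, so this reduces to right multiplication by [one_site A^T j]. *)
Lemma mulmx_one_two_site_l B A j k : j != k ->
  one_site A j *m two_site B j k = two_site ((A *t 1%:M) *m B) j k.
Proof.
move=> jk; apply: trmx_inj; rewrite trmx_mul tr_one_site !tr_two_site.
by rewrite mulmx_two_one_site_l // trmx_mul trmx_tens trmx1.
Qed.

Lemma mulmx_one_two_site_r B A j k : j != k ->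
  one_site A k *m two_site B j k = two_site ((1%:M *t A) *m B) j k.
Proof.
move=> jk; apply: trmx_inj; rewrite trmx_mul tr_one_site !tr_two_site.
by rewrite mulmx_two_one_site_r // trmx_mul trmx_tens trmx1.
Qed.

Lemma mulmx_two_one_siteE B A i j k x y : i != j -> i != k ->
  let s : config L := enum_val x in let t : config L := enum_val y in
  (two_site B j k *m one_site A i) x y =
  B (mxtens_index (s j, s k)) (mxtens_index (t j, t k)) * A (s i) (t i) *
  \prod_(l | [&& l != j, l != k & l != i]) (s l == t l)%:R.
Proof.
move=> ij ik s t; rewrite mulmx_one_siteE -/t (bigD1 (s i)) //=.
rewrite [X in _ + X]big1 ?addr0 => [|a ai]; rewrite mxE enum_rankK -/s.
  rewrite !ffunE ![_ == i]eq_sym (negbTE ij) (negbTE ik) mulrAC; congr (_ * _).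
  (* As [i] is neither [j] nor [k], the product of deltas in [two_site B j k] contains one at [i];
     it is 1 for [a = s i] and kills every other [a]. *)
  rewrite (bigD1 i) ?ij ?ik //= ffunE !eqxx mul1r.
  apply: eq_big => [l|l /andP[_ /negbTE li]]; first by rewrite andbA.
  by rewrite ffunE li.
rewrite (bigD1 i) ?ij ?ik //= [update t i a i]ffunE eqxx 
  [s i == a]eq_sym (negbTE ai).
by rewrite mul0r mulr0 mul0r.
Qed.

(** The entry formula above is unchanged when [A] and [B] are transposed and [x] and [y] are
    swapped, while transposing the product reverses its order. *)
Lemma two_site_comm_one_site B A i j k : i != j -> i != k ->
  two_site B j k *m one_site A i = one_site A i *m two_site B j k.
Proof.
move=> ij ik; apply/matrixP => x y.
rewrite -[in RHS](trmxK (one_site A i)) -[in RHS](trmxK (two_site B j k)).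
rewrite -trmx_mul tr_one_site tr_two_site [RHS]mxE.
rewrite !mulmx_two_one_siteE // !mxE; congr (_ * _).
by apply: eq_bigr => l _; rewrite eq_sym.
Qed.

Lemma two_siteB B C j k :
  two_site (B - C) j k = two_site B j k - two_site C j k.
Proof. by apply/matrixP => x y; rewrite !mxE mulrBl. Qed.

Lemma two_site0 j k : two_site (0 : 'M[K]_(2 * 2)) j k = 0.
Proof. by apply/matrixP => x y; rewrite !mxE mul0r. Qed.

Lemma commutator_two_site_staggered B A j k : j != k ->
  commutator B (A *t 1%:M - 1%:M *t A) = 0 ->
  commutator (two_site B j k) (one_site A j - one_site A k) = 0.
Proof.
move=> jk BA; rewrite /commutator mulmxBr mulmxBl.
rewrite mulmx_two_one_site_l // mulmx_two_one_site_r //.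
rewrite mulmx_one_two_site_l // mulmx_one_two_site_r //.
by rewrite -!two_siteB -mulmxBr -mulmxBl [X in two_site X]BA two_site0.
Qed.

Lemma signr_ordS j : ~~ odd L -> (-1) ^+ (ordS j).+1 = - (-1) ^+ j.+1 :> K.
Proof.
move=> evL; rewrite !exprS !mulN1r opprK -[RHS]signr_odd -[in LHS]signr_odd.
have : odd (ordS j) = ~~ odd j.
  (* Reduction modulo the even number [L] preserves parity, so the sign also flips at the
     wrap-around. *)
  rewrite /= -[~~ odd j]/(odd j.+1) [in RHS](divn_eq j.+1 L) oddD oddM.
  by rewrite (negbTE evL) andbF.
by move=> ->; case: (odd j); rewrite ?opprK.
Qed.

Lemma neq_ordS j : ~~ odd L -> j != ordS j.
Proof.
move=> evL; apply/eqP => /(congr1 val) /= jE.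
have := congr1 odd (divn_eq j.+1 L).
by rewrite oddD oddM (negbTE evL) andbF -jE /=; case: (odd j).
Qed.

Lemma commutator_suml n (I : finType) (F : I -> 'M[K]_n) (M : 'M[K]_n) :
  commutator (\sum_i F i) M = \sum_i commutator (F i) M.
Proof. by rewrite /commutator mulmx_suml mulmx_sumr -sumrB. Qed.

Lemma commutatorD n (M N P : 'M[K]_n) :
  commutator M (N + P) = commutator M N + commutator M P.
Proof. by rewrite /commutator mulmxDr mulmxDl opprD addrACA. Qed.

Lemma commutatorZ n (c : K) (M N : 'M[K]_n) :
  commutator M (c *: N) = c *: commutator M N.
Proof. by rewrite /commutator -scalemxAr -scalemxAl scalerBr. Qed.

Lemma commutator_hamiltonian_staggered B A : ~~ odd L ->
  commutator B (A *t 1%:M - 1%:M *t A) = 0 ->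
  commutator (hamiltonian L B) (\sum_(j < L) (-1) ^+ j.+1 *: one_site A j) = 0.
Proof.
move=> evL BA; rewrite commutator_suml big1 // => j _.
have jS := neq_ordS j evL.
(* Isolate the two sites where [two_site B j (ordS j)] acts: their terms form a signed difference,
   and all others commute with it. *)
rewrite (bigD1 j) //= (bigD1 (ordS j)) 1?eq_sym //= addrA signr_ordS //.
rewrite scaleNr -scalerBr commutatorD commutatorZ.
rewrite commutator_two_site_staggered // scaler0 add0r.
rewrite /commutator mulmx_sumr mulmx_suml -sumrB big1 // => i /andP[ij iS].
by rewrite -scalemxAr -scalemxAl two_site_comm_one_site // subrr.
Qed.

End ChainOperators.

(** The image of [D] is spanned by |00> and |01> - |10>, both killed by [U]; that of [U] by |00> and
    |01> + |10>, both killed by [D]. *)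
Lemma commutator_U_mx (K : comNzRingType) (b : K) :
  commutator (b *: U_mx K) (sigma_plus K *t 1%:M - 1%:M *t sigma_plus K) = 0.
Proof.
set D := _ - _.
have [UD DU] : U_mx K *m D = 0 /\ D *m U_mx K = 0.
  split; apply/matrixP; case=> [[|[|[|[|//]]]] lt_i] [[|[|[|[|//]]]] lt_j];
    rewrite mxE !big_ord_recl big_ord0 !mxE /=;
    by rewrite !(mul0r, mulr0, mul1r, mulr1, oppr0, addr0, add0r, subrr, addNr).
by rewrite /commutator -scalemxAl -scalemxAr UD DU scaler0 subrr.
Qed.

Theorem mainTheorem5 (R : realType) (b' : R[i]) (L : nat)
    (hL_pos : (0 < L)%N) (hL_even : ~~ odd L) :
  commutator (hamiltonian L (b' *: U_mx R[i])) (J_plus R[i] L) = 0.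
Proof.
exact/commutator_hamiltonian_staggered/commutator_U_mx.
Qed.
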